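(* For every weak composition $a$ of length $n$, \[\mathfrak{Q}_a=\sum_{\substack{b\ge a\\ \mathrm{flat}(b)=\mathrm{flat}(a)}}\mathcal{A}_b,\] where $b$ ranges over weak compositions of length $n$.
   Context: A weak composition of length $n$ is a sequence of $n$ nonnegative integers; $\mathrm{flat}(a)$ deletes zero parts; $b\ge a$ means $b_1+\cdots+b_i\ge a_1+\cdots+a_i$ for all $i$. $D(a)$: $a_i$ left-justified boxes in row $i$, row 1 lowest, columns numbered from the left. For a filling $S$ with positive integers, $x^{\mathrm{wt}(S)}=\prod_i x_i^{\#\{\text{entries } i\}}$. Demazure atom: a triple of $D(a)$ (rows $r<s$) is either Type A: boxes $\gamma=(r,c),\alpha=(r,c+1),\beta=(s,c+1)$ with $a_r\ge a_s$, or Type B: $\gamma=(s,c),\alpha=(s,c+1),\beta=(r,c)$ with $a_s>a_r$; it is an inversion triple if $\beta>\gamma\ge\alpha$ or $\gamma\ge\alpha>\beta$. $\mathcal{A}_a=\sum x^{\mathrm{wt}(S)}$ over fillings $S$ of $D(a)$ with positive integers whose rows weakly decrease left to right, whose column entries are distinct, all of whose triples are inversion triples, and whose first-column entry in each nonempty row $i$ equals $i$. Quasi-key tableau of shape $a$: filling of $D(a)$ with positive integers such that (1) entries weakly decrease along rows and no entry of row $i$ exceeds $i$; (2) entries in each column are distinct and increase going up the first column; (3) if an entry $i$ is above an entry $k$ in the same column with $i<k$, there is an entry $j$ immediately right of $k$ with $i<j$; (4) for two rows with the higher row strictly longer, if $i$ is in column $c$ of the lower row and $j$ in column $c+1$ of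 the higher row, then $i<j$. $\mathfrak{Q}_a=\sum x^{\mathrm{wt}(T)}$ over quasi-key tableaux $T$ of shape $a$. *)

(* Defs.v *)
From mathcomp Require Import all_boot all_order all_algebra.
From mathcomp Require Import mpoly.
Set Implicit Arguments. Unset Strict Implicit. Unset Printing Implicit Defensive.
Import GRing.Theory.
Local Open Scope ring_scope.

(* Conventions (0-based in Rocq, 1-based in the paper):
   - a weak composition of length n is  a : n.-tuple nat ; part a_{r+1} is tnth a r.
   - row index r : 'I_n  represents row r+1 (row 1 lowest).
   - column index c : nat represents column c+1.
   - box (r,c) of D(a) exists iff c < tnth a r.
   - an entry value k : 'I_n represents the positive integer k+1 and corresponds
     to the variable 'X_k  (= x_{k+1}). *)

Definition ncols (n : nat) (a : n.-tuple nat) : nat := \max_(i < n) tnth a i.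

(* A filling of D(a): Some entry on boxes, None off boxes (see in_shape). *)
Definition filling (n : nat) (a : n.-tuple nat) : finType :=
  {ffun 'I_n * 'I_(ncols a) -> option 'I_n}.

(* entry (as a positive nat, 0 when no box is there) at row r, column c *)
Definition ent (n : nat) (a : n.-tuple nat) (f : filling a) (r : 'I_n) (c : nat)
  : nat :=
  match @insub nat (fun c => c < ncols a)%N _ c with
  | Some c' => if f (r, c') is Some k then (k.+1)%N else 0%N
  | None => 0%N
  end.

Definition box (n : nat) (a : n.-tuple nat) (r : 'I_n) (c : nat) : bool :=
  (c < tnth a r)%N.

Definition in_shape (n : nat) (a : n.-tuple nat) (f : filling a) : bool :=
  [forall r : 'I_n, forall c : 'I_(ncols a), (f (r, c) != None) == box a r c].

Definition rows_weakly_decr (n : nat) (a : n.-tuple nat) (f : filling a) : bool :=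
  [forall r : 'I_n, forall c : 'I_(ncols a),
     box a r c.+1 ==> (ent f r c.+1 <= ent f r c)%N].

Definition cols_distinct (n : nat) (a : n.-tuple nat) (f : filling a) : bool :=
  [forall r : 'I_n, forall s : 'I_n, forall c : 'I_(ncols a),
     [&& r != s, box a r c & box a s c] ==> (ent f r c != ent f s c)].

Definition wt (n : nat) (a : n.-tuple nat) (f : filling a) : {mpoly int[n]} :=
  \prod_(rc : 'I_n * 'I_(ncols a)) (if f rc is Some k then 'X_k else 1).

Definition inv_triple (b g al : nat) : bool :=
  (((g < b) && (al <= g)) || ((al <= g) && (b < al)))%N.

Definition triples_ok (n : nat) (a : n.-tuple nat) (f : filling a) : bool :=
  [forall r : 'I_n, forall s : 'I_n, forall c : 'I_(ncols a),
    (r < s)%N ==>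
    ([&& (tnth a s <= tnth a r)%N, box a r c, box a r c.+1 & box a s c.+1] ==>
        inv_triple (ent f s c.+1) (ent f r c) (ent f r c.+1)) &&
    ([&& (tnth a r < tnth a s)%N, box a s c, box a s c.+1 & box a r c] ==>
        inv_triple (ent f r c) (ent f s c) (ent f s c.+1))].

Definition first_col_is_row (n : nat) (a : n.-tuple nat) (f : filling a) : bool :=
  [forall r : 'I_n, box a r 0 ==> (ent f r 0 == r.+1)].

Definition atom_filling (n : nat) (a : n.-tuple nat) (f : filling a) : bool :=
  [&& in_shape f, rows_weakly_decr f, cols_distinct f, triples_ok f
    & first_col_is_row f].

Definition atom (n : nat) (a : n.-tuple nat) : {mpoly int[n]} :=
  \sum_(f : filling a | atom_filling f) wt f.

Definition qk_cond1 (n : nat) (a : n.-tuple nat) (f : filling a) : bool :=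
  rows_weakly_decr f &&
  [forall r : 'I_n, forall c : 'I_(ncols a), box a r c ==> (ent f r c <= r.+1)%N].

Definition qk_cond2 (n : nat) (a : n.-tuple nat) (f : filling a) : bool :=
  cols_distinct f &&
  [forall r : 'I_n, forall s : 'I_n,
     [&& (r < s)%N, box a r 0 & box a s 0] ==> (ent f r 0 < ent f s 0)%N].

Definition qk_cond3 (n : nat) (a : n.-tuple nat) (f : filling a) : bool :=
  [forall r : 'I_n, forall s : 'I_n, forall c : 'I_(ncols a),
     [&& (r < s)%N, box a r c, box a s c & (ent f s c < ent f r c)%N] ==>
       (box a r c.+1 && (ent f s c < ent f r c.+1)%N)].

Definition qk_cond4 (n : nat) (a : n.-tuple nat) (f : filling a) : bool :=
  [forall r : 'I_n, forall s : 'I_n, forall c : 'I_(ncols a),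
     [&& (r < s)%N, (tnth a r < tnth a s)%N, box a r c & box a s c.+1] ==>
       (ent f r c < ent f s c.+1)%N].

Definition quasi_key (n : nat) (a : n.-tuple nat) (f : filling a) : bool :=
  [&& in_shape f, qk_cond1 f, qk_cond2 f, qk_cond3 f & qk_cond4 f].

Definition qkey_poly (n : nat) (a : n.-tuple nat) : {mpoly int[n]} :=
  \sum_(f : filling a | quasi_key f) wt f.

Definition flat (s : seq nat) : seq nat := [seq x <- s | x != 0%N].

Definition dominates (b a : seq nat) : bool :=
  [forall i : 'I_(size a).+1, (sumn (take i a) <= sumn (take i b))%N].

Definition tuple_of_bounded (n m : nat) (b : n.-tuple 'I_m) : n.-tuple nat :=
  map_tuple (fun x : 'I_m => nat_of_ord x) b.

(* Main.v *)
(* Idea. Quasi-key tableaux of shape a and atom fillings of the shapes b occurring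
   on the right are both determined by the sets of entries of their columns, and the
   same families of column sets occur on both sides; the weight only depends on these
   sets. Moving the row of a quasi-key tableau with first entry i down to row i
   produces the shapes b, so one may assume that the first column records the rows.
   Existence: if each column set dominates the next one, a filling of either kind
   is obtained by removing one greedily chosen row and recursing. Uniqueness and
   equality of shapes: for given column sets the counts
   #{r < k : h r c >= t} are maximal for atom fillings, while the counts
   #{r : row r reaches column m, h r c < t} are maximal for quasi-key tableaux. At
   (c, t) = (m, 1), respectively c = 0, both count the low rows that reach column
   m, so the two shapes coincide. *)
Require Import Defs.
From mathcomp Require Import all_boot all_order all_algebra.
From mathcomp Require Import mpoly.
From mathcomp Require Import zify.
Set Implicit Arguments.
Unset Strict Implicit.
Unset Printing Implicit Defensive.

(** * Partial fillings as functions, and their column sets *)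

(* Fillings are modelled by functions [h] of the row and the column, whose value is
   the entry (shifted as in [ent]) and 0 where there is no box. *)
Record partial_filling n (h : 'I_n -> nat -> nat) : Prop := PartialFilling {
  row_decr : forall r c, h r c.+1 <= h r c;
  col_inj : forall r s c, 0 < h r c -> h r c = h s c -> r = s;
  entry_le : forall r c, h r c <= n }.

Definition starts_at_row n (h : 'I_n -> nat -> nat) :=
  forall r, 0 < h r 0 -> h r 0 = r.+1.

(* The type A and type B inversion conditions merge into this one, which does not
   mention row lengths. *)
Definition atomic n (h : 'I_n -> nat -> nat) :=
  forall (r s : 'I_n) c, r < s -> 0 < h s c.+1 -> h s c.+1 <= h r c ->
  h s c.+1 < h r c.+1.

Definition cond3 n (h : 'I_n -> nat -> nat) :=
  forall (r s : 'I_n) c, r < s -> 0 < h s c -> h s c < h r c -> h s c < h r c.+1.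

(* Column [m] witnesses that row [s] is longer than row [r]. *)
Definition cond4 n (h : 'I_n -> nat -> nat) :=
  forall (r s : 'I_n) c m, r < s -> h r m = 0 -> 0 < h s m -> 0 < h r c ->
  h r c < h s c.+1.

(* Value [k.+1] of [h] is represented by [k : 'I_n]. *)
Definition col n (h : 'I_n -> nat -> nat) (c : nat) : {set 'I_n} :=
  [set k : 'I_n | [exists r, h r c == k.+1]].

Lemma colP n (h : 'I_n -> nat -> nat) c (k : 'I_n) :
  reflect (exists r, h r c = k.+1) (k \in col h c).
Proof.
rewrite inE; apply: (iffP existsP) => -[r]; first by move/eqP; exists r.
by move=> e; exists r; apply/eqP.
Qed.

Lemma entry_col n (h : 'I_n -> nat -> nat) r c : partial_filling h ->
  0 < h r c -> exists2 k : 'I_n, k \in col h c & h r c = k.+1.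
Proof.
move=> ph h0; have lt : (h r c).-1 < n by have := entry_le ph r c; lia.
have e : h r c = (Ordinal lt).+1 by rewrite /=; lia.
by exists (Ordinal lt) => //; apply/colP; exists r.
Qed.

Lemma row_decr_le n (h : 'I_n -> nat -> nat) r c d : partial_filling h ->
  c <= d -> h r d <= h r c.
Proof.
move=> ph /subnK <-; elim: (d - c) => [|e IH] //.
by rewrite addSn (leq_trans (row_decr ph _ _)).
Qed.

(** Entries of a column are distinct, so sending a row to its entry is a bijection onto the column
    set. *)
Lemma card_col n (h : 'I_n -> nat -> nat) c (P : pred nat) : partial_filling h ->
  #|[set r | (0 < h r c) && P (h r c)]| = #|[set k in col h c | P k.+1]|.
Proof.
move=> ph; set A := [set r | _].
pose f r := insubd r (h r c).-1.
have fE r : r \in A -> (f r).+1 = h r c.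
  rewrite inE => /andP[h0 _]; have := entry_le ph r c.
  by rewrite /f val_insubd; case: ifP; lia.
rewrite -(@card_in_imset _ _ f A) => [|r s rA sA e]; last first.
  apply: (col_inj ph (c := c)); first by move: rA; rewrite inE => /andP[].
  by rewrite -(fE r) // -(fE s) // e.
congr #|pred_of_set _|; apply/setP=> k; rewrite !inE; apply/imsetP/idP.
  move=> [r rA ->]; rewrite (fE r rA); move: (rA); rewrite inE => /andP[_ ->].
  by rewrite andbT; apply/existsP; exists r.
move=> /andP[/existsP[r /eqP hr] Pk]; have rA : r \in A by rewrite inE hr Pk.
by exists r => //; apply/val_inj/succn_inj; rewrite fE.
Qed.

Lemma card_same_col n (h g : 'I_n -> nat -> nat) c (P : pred nat) :
  partial_filling h -> partial_filling g -> col h c = col g c ->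
  #|[set r | (0 < h r c) && P (h r c)]| = #|[set r | (0 < g r c) && P (g r c)]|.
Proof. by move=> ph pg e; rewrite !card_col // e. Qed.

Lemma start_col n (h : 'I_n -> nat -> nat) (r : 'I_n) : starts_at_row h ->
  (0 < h r 0) = (r \in col h 0).
Proof.
move=> sh; apply/idP/colP => [/sh e|[s e]]; first by exists r.
have := sh s; rewrite e => /(_ isT) [] /val_inj rs.
by rewrite {1}rs e.
Qed.

Lemma start_eq n (h g : 'I_n -> nat -> nat) (r : 'I_n) :
  starts_at_row h -> starts_at_row g -> col h 0 = col g 0 -> h r 0 = g r 0.
Proof.
move=> sh sg e; have := start_col r sh; rewrite e -start_col //.
by have := sh r; have := sg r; case: (posnP (h r 0)); case: (posnP (g r 0)); lia.
Qed.

(** * Extremal counts and uniqueness for given column sets *)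

(* Cutting column [c.+1] at the least entry [w >= t] lying in a row [>= k]
   gives equality for atomic fillings in an inequality valid for all fillings. *)
Lemma atomic_count_max n (h f : 'I_n -> nat -> nat) :
  partial_filling h -> starts_at_row h ->
  partial_filling f -> starts_at_row f -> atomic f ->
  (forall c, col h c = col f c) ->
  forall c t k, 0 < t ->
  #|[set r : 'I_n | (r < k) && (t <= h r c)]| <=
  #|[set r : 'I_n | (r < k) && (t <= f r c)]|.
Proof.
move=> ph sh pf sf af e; elim=> [|c IH] t k t0.
  by rewrite (eq_card (B := [set r : 'I_n | (r < k) && (t <= f r 0)])) // => r;
     rewrite !inE (@start_eq _ h f).
(* Without such an entry, all entries [>= t] of [f] in column [c.+1] lie in rows [< k], so the count
   for [f] is that of the whole column. *)
have [/existsP[s0 s0P]|/existsPn noS] :=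
    boolP [exists s : 'I_n, (k <= s) && (t <= f s c.+1)]; last first.
  have := @card_same_col _ h f c.+1 (leq t) ph pf (e _).
  set A := [set r | _]; set B := [set r | _] => AB.
  apply: (@leq_trans #|A|).
    by apply/subset_leq_card/subsetP=> r; rewrite !inE; lia.
  rewrite AB; apply/subset_leq_card/subsetP=> r; rewrite !inE.
  by have := noS r; lia.
case: (@arg_minnP _ s0 (fun s => (k <= s) && (t <= f s c.+1))
  (fun s => f s c.+1) s0P) => s /andP[ks ts] smin.
set w := f s c.+1 in ts smin.
have := @card_same_col _ h f c.+1 (fun v => t <= v < w) ph pf (e _).
set A := [set r | _]; set B := [set r | _] => AB.
have w0 : 0 < w by lia.
have := IH w k w0; set A' := [set r | _]; set B' := [set r | _] => AB'.
(* Atomicity against row [s] turns an entry [>= w] in column [c] of a row below [k] into an entry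
   [> w] in column [c.+1]. Rows of [B] lie below [k] by minimality of [w]. *)
have BB' : [disjoint B & B'].
  rewrite disjoints_subset; apply/subsetP=> r; rewrite !inE.
  case: (ltnP r k) => // rk /andP[_ /andP[tf fw]]; apply/negP => /= wf.
  have := af r s c; rewrite -/w; lia.
apply: (@leq_trans #|A :|: A'|).
  apply/subset_leq_card/subsetP=> r; rewrite !inE.
  by have := row_decr ph r c; lia.
apply: (@leq_trans #|B :|: B'|).
  rewrite [leqRHS]cardsU disjoint_setI0 // cards0 subn0.
  by rewrite (leq_trans (leq_card_setU _ _)) // AB leq_add2l.
apply/subset_leq_card/subsetP=> r; rewrite !inE => /orP[].
  by have := smin r; lia.
by have := af r s c; rewrite -/w; lia.
Qed.

(** Passing from [k = r] to [k = r.+1] lets only row [r] enter the count. *)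
Lemma eq_of_prefix_cards n (P Q : pred 'I_n) :
  (forall k, #|[set r : 'I_n | (r < k) && P r]| = #|[set r : 'I_n | (r < k) && Q r]|) ->
  P =1 Q.
Proof.
move=> eqc r.
have split (S : pred 'I_n) : #|[set s : 'I_n | (s < r.+1) && S s]| =
    S r + #|[set s : 'I_n | (s < r) && S s]|.
  rewrite (cardsD1 r) inE ltnSn /=; congr (_ + _); apply: eq_card => s.
  rewrite !inE ltnS [s <= r]leq_eqVlt -val_eqE /=.
  by case: (ltngtP s r).
have := eqc r.+1; rewrite !split eqc => /eqP; rewrite eqn_add2r.
by case: (P r); case: (Q r).
Qed.

(** Both fillings have maximal counts, so the counts agree, and an entry is determined by the
    positive thresholds that it reaches. *)
Lemma atomic_uniq n (h f : 'I_n -> nat -> nat) :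
  partial_filling h -> starts_at_row h -> atomic h ->
  partial_filling f -> starts_at_row f -> atomic f ->
  (forall c, col h c = col f c) -> forall r c, h r c = f r c.
Proof.
move=> ph sh ah pf sf af e r c.
have eqt t : 0 < t -> (t <= h r c) = (t <= f r c).
  move=> t0; apply: (@eq_of_prefix_cards n (fun r => t <= h r c)
     (fun r => t <= f r c)) => k.
  by apply/eqP; rewrite eqn_leq !atomic_count_max.
case: (posnP (h r c)) (posnP (f r c)) => [h0|h0] [f0|f0].
- by lia.
- by have := eqt _ f0; lia.
- by have := eqt _ h0; lia.
by have := eqt _ f0; have := eqt _ h0; lia.
Qed.

(* Dual cut: column [c] is cut at its largest entry [< t] in a row not
   reaching column [m]. *)
Lemma quasi_count_max n (h g : 'I_n -> nat -> nat) :
  partial_filling h -> partial_filling g -> cond3 g -> cond4 g ->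
  (forall c, col h c = col g c) ->
  forall m d c t, m = c + d ->
  #|[set r : 'I_n | (0 < h r m) && (h r c < t)]| <=
  #|[set r : 'I_n | (0 < g r m) && (g r c < t)]|.
Proof.
move=> ph pg c3 c4 e m; elim=> [|d IH] c t mE.
  rewrite mE addn0.
  by rewrite (@card_same_col _ h g c (fun v => v < t)).
have cm : c <= m by lia.
have cm1 : c.+1 <= m by lia.
have [/existsP[s0 s0P]|/existsPn noS] :=
    boolP [exists s, [&& 0 < g s c, g s c < t & g s m == 0]]; last first.
  have := @card_same_col _ h g c (fun v => v < t) ph pg (e _).
  set A := [set r | _]; set B := [set r | _] => AB.
  apply: (@leq_trans #|A|).
    apply/subset_leq_card/subsetP=> r; rewrite !inE.
    by have := row_decr_le r ph cm; lia.
  rewrite AB; apply/subset_leq_card/subsetP=> r; rewrite !inE.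
  by have := noS r; lia.
case: (@arg_maxnP _ s0 (fun s => [&& 0 < g s c, g s c < t & g s m == 0])
  (fun s => g s c) s0P) => s /and3P[vpos vt /eqP sm] smax.
set v := g s c in vpos vt smax.
have := @card_same_col _ h g c (fun u => v < u < t) ph pg (e _).
set A := [set r | _]; set B := [set r | _] => AB.
have := IH c.+1 v.+1; rewrite {1}mE addnS => /(_ erefl).
set A' := [set r | _]; set B' := [set r | _] => AB'.
(* A row reaching column [m] cannot drop from above [v] to at most [v] after column [c]: [cond3]
   forbids it below row [s], [cond4] above row [s]. *)
have key r : 0 < g r m -> g r c.+1 <= v -> g r c <= v.
  move=> rm gv; case: (ltngtP r s) => [rs|sr|/val_inj ->] //.
    by have := c3 r s c; rewrite -/v; lia.
  by have := c4 s r c m; rewrite -/v; lia.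
have BB' : [disjoint B & B'].
  rewrite disjoints_subset; apply/subsetP=> r; rewrite !inE.
  by have := key r; lia.
apply: (@leq_trans #|A :|: A'|).
  apply/subset_leq_card/subsetP=> r; rewrite !inE.
  have := row_decr_le r ph cm; have := row_decr ph r c; lia.
apply: (@leq_trans #|B :|: B'|).
  rewrite [leqRHS]cardsU disjoint_setI0 // cards0 subn0.
  by rewrite (leq_trans (leq_card_setU _ _)) // AB leq_add2l.
apply/subset_leq_card/subsetP=> r; rewrite !inE => /orP[].
  have := smax r; case: (g r m) => [|?]; lia.
by have := key r; lia.
Qed.

(** Rows below [k] reaching column [c] are counted by [atomic_count_max] at [t = 1], and by
    [quasi_count_max] in the first column at threshold [k.+1], where an entry [< k.+1] belongs to a
    row [< k]. *)
Lemma atomic_quasi_shape n (f g : 'I_n -> nat -> nat) :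
  partial_filling f -> starts_at_row f -> atomic f ->
  partial_filling g -> starts_at_row g -> cond3 g -> cond4 g ->
  (forall c, col f c = col g c) -> forall r c, (0 < f r c) = (0 < g r c).
Proof.
move=> pf sf af pg sg c3 c4 e r c.
apply: (@eq_of_prefix_cards n (fun r => 0 < f r c) (fun r => 0 < g r c)) => k.
apply/eqP; rewrite eqn_leq; apply/andP; split; last first.
  by apply: atomic_count_max.
have := @quasi_count_max _ f g pf pg c3 c4 e c c 0 k.+1 (erefl _).
have eqs h : partial_filling h -> starts_at_row h ->
    [set s | (0 < h s c) && (h s 0 < k.+1)] = [set s : 'I_n | (s < k) && (0 < h s c)].
  move=> ph sh; apply/setP=> s; rewrite !inE andbC.
  have := sh s; have := row_decr_le s ph (leq0n c); lia.
by rewrite !eqs.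
Qed.

(** Agreement spreads from the empty columns beyond [N] to the left, and within a column from the
    bottom row up. *)
Lemma quasi_uniq n (h g : 'I_n -> nat -> nat) :
  partial_filling h -> cond3 h -> cond4 h ->
  partial_filling g -> cond3 g -> cond4 g ->
  (forall r c, (0 < h r c) = (0 < g r c)) ->
  (forall c, col h c = col g c) -> (exists N, forall r c, N <= c -> h r c = 0) ->
  forall r c, h r c = g r c.
Proof.
move=> ph h3 h4 pg g3 g4 esh e [N hN].
(* If [f1 r c] exceeded [f2 r c], the latter value would occur in [f1] above row [r], and [cond3]
   would make [f1 r c.+1] exceed it, although [f1 r c.+1 = f2 r c.+1 <= f2 r c]. *)
have key f1 f2 (r : 'I_n) c : partial_filling f1 -> cond3 f1 -> cond4 f1 ->
    partial_filling f2 ->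
    (forall r c, (0 < f1 r c) = (0 < f2 r c)) ->
    (forall c, col f1 c = col f2 c) ->
    (forall r, f1 r c.+1 = f2 r c.+1) ->
    (forall s : 'I_n, s < r -> f1 s c = f2 s c) -> 0 < f1 r c -> f1 r c <= f2 r c.
  move=> p1 h31 h41 p2 esh' e' IHc IHr pos.
  have pos2 : 0 < f2 r c by rewrite -esh'.
  have [k kc kE] := entry_col p2 pos2.
  move: kc; rewrite -e' => /colP[s sE]; rewrite kE -sE.
  have r12 : f1 r c.+1 <= f1 s c by rewrite IHc sE -kE; apply: row_decr.
  case: (ltngtP s r) => [sr|rs|/val_inj -> //].
    have : f2 s c = f2 r c by rewrite -(IHr s) // sE kE.
    move=> es; have : s = r by apply: (col_inj p2 _ es); rewrite es.
    by move=> sr'; rewrite sr' ltnn in sr.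
  have s0 : 0 < f1 s c by rewrite sE.
  by rewrite leqNgt; apply/negP => lt; have := h31 r s c rs s0 lt; lia.
suff main d : forall c, N <= c + d -> forall r, h r c = g r c.
  by move=> r c; apply: (main N); lia.
elim: d => [|d IH] c cN r.
  by have := esh r c; rewrite hN; lia.
have IHc s : h s c.+1 = g s c.+1 by apply: IH; lia.
move: {2}(val r) (leqnn r) => q; elim: q r => [|q IHq] r rq.
  all: case: (posnP (h r c)) => [h0|h0]; first by have := esh r c; lia.
  all: have g0 : 0 < g r c by rewrite -esh.
  all: by apply/eqP; rewrite eqn_leq; apply/andP; split; apply: key => // s sr;
    rewrite ?IHq //; lia.
Qed.

(** * Existence of fillings with prescribed column sets *)

(** With columns sorted decreasingly, each entry of column [c.+1] is at most its counterpart in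
    column [c]: the Hall condition for weakly decreasing rows. *)
Definition dominated_cols n (C : nat -> {set 'I_n}) :=
  forall c t, #|[set k in C c.+1 | t <= k]| <= #|[set k in C c | t <= k]|.

(** Where the path has ended, [P c] is 0 and nothing is removed, since [k.+1] is never 0. *)
Definition delete_path n (C : nat -> {set 'I_n}) (P : nat -> nat) c : {set 'I_n} :=
  [set k in C c | k.+1 != P c].

Lemma card_delete_path n (C : nat -> {set 'I_n}) (P : nat -> nat) c :
  (0 < P c -> exists2 k, k \in C c & P c = k.+1) -> forall t, t < P c ->
  #|[set k in C c | t <= k]| = #|[set k in delete_path C P c | t <= k]|.+1.
Proof.
move=> PC t tP; have [|k kC Pk] := PC; first lia.
rewrite (cardsD1 k) inE kC (_ : (t <= k) = true) ?add1n; last lia.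
congr _.+1; apply: eq_card => i; rewrite !inE Pk eqSS.
by rewrite andbCA andbA [_ && (i != k)]andbC.
Qed.

Lemma dominated_col n (h : 'I_n -> nat -> nat) : partial_filling h ->
  dominated_cols (col h).
Proof.
move=> ph c t; have := @card_col n h c.+1 (fun v => t < v) ph.
have := @card_col n h c (fun v => t < v) ph => /= <- <-.
apply/subset_leq_card/subsetP=> r; rewrite !inE.
by have := row_decr ph r c; lia.
Qed.

Lemma dominated_empty n (C : nat -> {set 'I_n}) c d : dominated_cols C ->
  C c = set0 -> c <= d -> C d = set0.
Proof.
move=> dC C0 /subnK <-; elim: (d - c) => [|e IH] //.
rewrite addSn; apply/eqP; rewrite -cards_eq0 -leqn0.
have all0 (A : {set 'I_n}) : [set k in A | 0 <= k] = A.
  by apply/setP=> k; rewrite inE leq0n andbT.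
by have := dC (e + c) 0; rewrite !all0 IH cards0.
Qed.

(** Row [r] is free in [h]: an entry there would force the first entry [r.+1], which the path has
    removed. *)
Lemma add_row n (C : nat -> {set 'I_n}) (P : nat -> nat) (r : 'I_n)
    (h : 'I_n -> nat -> nat) :
  P 0 = r.+1 -> (forall c, P c.+1 <= P c) ->
  (forall c, 0 < P c -> exists2 k, k \in C c & P c = k.+1) ->
  partial_filling h -> starts_at_row h -> (forall c, col h c = delete_path C P c) ->
  let g i c := if i == r then P c else h i c in
  [/\ partial_filling g, starts_at_row g & forall c, col g c = C c].
Proof.
move=> P0 Pdecr PC ph sh hC g.
have hP i c : 0 < h i c -> exists2 k, k \in C c & h i c = k.+1 /\ k.+1 <> P c.
  move=> /(entry_col ph)[k]; rewrite hC inE => /andP[kC kP] e.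
  by exists k => //; split=> //; apply/eqP.
have r0 c : h r c = 0.
  apply/eqP; rewrite -leqn0 (leq_trans (row_decr_le r ph (leq0n c))) // leqn0.
  apply/eqP; case: (posnP (h r 0)) => // rpos.
  by have [k _ []] := hP _ _ rpos; rewrite P0 sh //; lia.
split.
- split=> [i c|i j c|i c]; rewrite /g.
  + by case: ifP => // _; apply: row_decr.
  + case: eqP => [->|_]; case: eqP => [-> //|_].
    * by move=> Ppos e; have [|k _ []] := hP j c; rewrite -e //; lia.
    * by move=> hpos e; have [k _ []] := hP i c hpos; rewrite -e; lia.
    * exact: (col_inj ph).
  + case: ifP => _; last exact: entry_le.
    by case: (posnP (P c)) => [-> //|/PC[k _ ->]].
- by move=> i; rewrite /g; case: eqP => [->|_] //; apply: sh.
move=> c; apply/setP=> k; apply/colP/idP => [[i]|kC].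
  rewrite /g; case: eqP => [_|_] e.
    by have [|k' k'C] := PC c; rewrite e // => -[/val_inj ->].
  by have [|k' k'C] := hP i c; rewrite e // => -[[/val_inj ->]].
case: (eqVneq k.+1 (P c)) => [e|ne]; first by exists r; rewrite /g eqxx.
have : k \in col h c by rewrite hC inE kC.
case/colP=> i e; exists i; rewrite /g; case: eqP => // ir.
by rewrite ir r0 in e.
Qed.

(* Started at the least entry of the first column, this is forced to be the
   lowest row of an atomic filling. *)
Fixpoint descending_path n (C : nat -> {set 'I_n}) (v c : nat) : nat :=
  if c is c'.+1 then \max_(k in C c | k < descending_path C v c') k.+1 else v.

Lemma descending_pathS n (C : nat -> {set 'I_n}) (v c : nat) :
  let P := descending_path C v in
  [/\ P c.+1 <= P c,
      0 < P c.+1 -> exists2 k, k \in C c.+1 & P c.+1 = k.+1 &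
      forall k, k \in C c.+1 -> k < P c -> k < P c.+1].
Proof.
move=> P; rewrite {1 3 4 6}/P /= -/P; split.
- by apply/bigmax_leqP => k /andP[].
- case: (pickP (fun k => (k \in C c.+1) && (k < P c))) => [k0 k0P _|no]; last first.
    by rewrite big_pred0.
  by have [|k /andP[kC _] e] := @eq_bigmax_cond _
    (fun k => (k \in C c.+1) && (k < P c)) (fun k : 'I_n => k.+1);
    [by apply/card_gt0P; exists k0 | exists k].
- move=> k kC kP; have := @leq_bigmax_cond _ (fun k => (k \in C c.+1) && (k < P c))
    (fun k : 'I_n => k.+1) k; rewrite kC kP; exact.
Qed.

(** Removing the greedy path preserves dominance, and it returns as the lowest nonempty row, so
    atomicity is new only for pairs having it as the lower row. *)
Lemma exists_atomic n (C : nat -> {set 'I_n}) : dominated_cols C ->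
  exists h, [/\ partial_filling h, starts_at_row h, atomic h &
                forall c, col h c = C c].
Proof.
move: {2}#|C 0| (leqnn #|C 0|) => q; elim: q C => [|q IH] C.
  rewrite leqn0 cards_eq0 => /eqP C0 dC; exists (fun _ _ => 0); split=> // c.
  rewrite (dominated_empty dC C0 (leq0n c)); apply/setP=> k; rewrite in_set0.
  by apply/colP => -[].
move=> qC dC; case: (set_0Vmem (C 0)) => [C0|[r0 r0C]].
  by apply: IH => //; rewrite C0 cards0.
case: (@arg_minnP _ r0 (fun k => k \in C 0) val r0C) => r rC rmin.
pose P := descending_path C r.+1.
have P0 : P 0 = r.+1 by [].
have PS c : P c.+1 <= P c by case: (descending_pathS C r.+1 c).
have PC c : 0 < P c -> exists2 k, k \in C c & P c = k.+1.
  by case: c => [|c]; [exists r | case: (descending_pathS C r.+1 c)].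
have Pmax c k : k \in C c.+1 -> k < P c -> k < P c.+1.
  by case: (descending_pathS C r.+1 c) => _ _; apply.
clearbody P.
have [|c t|h [ph sh ah hC]] := IH (delete_path C P).
- have := cardsD1 r (C 0); rewrite rC; set A := _ :\ r.
  suff -> : A = delete_path C P 0 by lia.
  by apply/setP=> k; rewrite !inE P0 eqSS andbC.
- case: (leqP (P c) t) => [Pt|Pt].
    apply: leq_trans (leq_trans (dC c t) _); apply/subset_leq_card/subsetP=> k;
    by rewrite !inE; case: (k \in _); lia.
  (* If [P c.+1 <= t < P c], only column [c] loses a counted entry. By greediness column [c.+1] has
     no [k] with [t <= k < P c], so dominance at [P c] suffices. *)
  case: (leqP (P c.+1) t) => [Pt'|Pt'].
    apply: (leq_trans _ (leq_trans (dC c (P c)) _)); apply/subset_leq_card/subsetP=> k;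
      rewrite !inE; case kC: (k \in _) => //=; last by lia.
    by have := Pmax c k kC; lia.
  have cardD d := card_delete_path (PC d).
  by rewrite -ltnS -!(cardD _ t).
have := add_row P0 PS PC ph sh hC.
set g := fun i c => _ => -[pg sg gC]; exists g; split=> // i j c.
have gP s : 0 < g s 0 -> r <= s.
  by rewrite start_col // gC => /rmin.
move=> ij jpos gji.
have ri : r <= i.
  by apply/gP/(leq_trans jpos)/(leq_trans gji)/row_decr_le.
have jr : (j == r) = false by apply/negbTE/eqP=> jr; rewrite jr ltnNge ri in ij.
(* If [i = r], an entry [<= P c] of row [j] in column [c.+1] is at most [P c.+1] by greediness, and
   differs from it because the path was removed. *)
move: jpos gji; rewrite /g jr; case: eqP => [_|_ jpos gji]; last exact: ah.
move=> hj hP; have [k] := entry_col ph hj; rewrite hC inE => /andP[kC kP] e.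
by have := Pmax c k kC; lia.
Qed.

(* From right to left the path takes in each column the least entry it can; it
   is forced to be the lowest among the longest rows of a quasi-key tableau. *)
Lemma ascending_path n N (C : nat -> {set 'I_n}) : dominated_cols C ->
  (forall c, N <= c -> C c = set0) ->
  exists P : nat -> nat, [/\ forall c, P c.+1 <= P c,
    forall c, 0 < P c -> exists2 k, k \in C c & P c = k.+1,
    forall c k, k \in C c -> P c.+1 <= k.+1 -> P c <= k.+1 &
    forall c, C c != set0 -> 0 < P c].
Proof.
elim: N C => [|N IH] C dC C0.
  exists (fun=> 0); split=> // c.
  by rewrite C0 // eqxx.
have [|c Nc|Q [QS QC Qmin Q0]] := IH (fun c => C c.+1).
- by move=> c t; apply: dC.
- exact: C0.
(* The path [Q] of the later columns is extended to the left by the least entry not smaller than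
   [Q 0]. *)
pose ok (k : 'I_n) := (k \in C 0) && (Q 0 <= k.+1).
case: (pickP ok) => [k0 k0P|no].
  case: (@arg_minnP _ k0 ok val k0P) => k /andP[kC Qk] kmin.
  exists (fun c => if c is c'.+1 then Q c' else k.+1).
  split=> [[|c]|[|c]|[|c] i iC|[|c]] //.
  - by exists k.
  - exact: QC.
  - by move=> Qi; rewrite ltnS; apply: kmin; rewrite /ok iC.
  - exact: Qmin.
  exact: Q0.
(* If no such entry exists, dominance at the entry [Q 0] excludes a nonempty path; the first column
   is then empty too. *)
have Q00 : Q 0 = 0.
  apply/eqP; rewrite -leqn0 leqNgt; apply/negP => Qpos.
  have [k kC Qk] := QC 0 Qpos.
  have := dC 0 k; rewrite leqNgt => /negP; apply.
  apply: (@leq_ltn_trans 0); last by apply/card_gt0P; exists k; rewrite inE kC /=.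
  rewrite leqn0; apply/eqP/eq_card0 => i; rewrite !inE.
  by have := no i; rewrite /ok Qk ltnS.
have CE : C 0 = set0.
  by apply/setP=> i; rewrite inE; have := no i; rewrite /ok Q00 andbT.
exists (fun c => if c is c'.+1 then Q c' else 0).
split=> [[|c]|[|c]|[|c] i iC|[|c]] //.
- by rewrite Q00.
- exact: QC.
- exact: Qmin.
- by rewrite CE eqxx.
exact: Q0.
Qed.

(** The ascending path is removed and reinserted as row [r]. It reaches every nonempty column, so no
    row is longer, and its minimality gives [cond3] against higher rows. *)
Lemma exists_quasi n N (C : nat -> {set 'I_n}) : dominated_cols C ->
  (forall c, N <= c -> C c = set0) ->
  exists h, [/\ partial_filling h, starts_at_row h, cond3 h, cond4 h &
                forall c, col h c = C c].
Proof.
move: {2}#|C 0| (leqnn #|C 0|) => q; elim: q C => [|q IH] C.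
  rewrite leqn0 cards_eq0 => /eqP C0 dC _; exists (fun _ _ => 0); split=> // c.
  rewrite (dominated_empty dC C0 (leq0n c)); apply/setP=> k; rewrite in_set0.
  by apply/colP => -[].
move=> qC dC CN; have [C0|C0] := eqVneq (C 0) set0.
  by apply: IH => //; rewrite C0 cards0.
have [P [PS PC Pmin Pne]] := ascending_path dC CN.
have [r rC rP] := PC 0 (Pne 0 C0).
have [|c t|c Nc|h [ph sh h3 h4 hC]] := IH (delete_path C P).
- have := cardsD1 r (C 0); rewrite rC; set A := _ :\ r.
  suff -> : A = delete_path C P 0 by lia.
  by apply/setP=> k; rewrite !inE rP eqSS andbC.
- case: (leqP (P c) t) => [Pt|Pt].
    apply: leq_trans (leq_trans (dC c t) _); apply/subset_leq_card/subsetP=> k;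
    by rewrite !inE; case: (k \in _); lia.
  have cardD d := card_delete_path (PC d).
  rewrite -ltnS -(cardD c t) //.
  case: (leqP (P c.+1) t) => [Pt'|Pt']; last by rewrite -(cardD _ t).
  have [C1|C1] := eqVneq (C c.+1) set0.
    rewrite (_ : #|_| = 0); last by apply: eq_card0 => k; rewrite !inE C1 inE.
    have [|k kC Pk] := PC c; first lia.
    by apply/card_gt0P; exists k; rewrite inE kC; lia.
  have [p pC Pp] := PC c.+1 (Pne _ C1).
  (* Here [P c.+1 = p.+1 <= t < P c]. Counting from [p] on includes the path entry and gives
     strictness; by minimality, column [c] has no [k] with [p <= k < t]. *)
  apply: (@leq_trans #|[set k in C c.+1 | p <= k]|).
    rewrite [leqRHS](cardsD1 p) inE pC leqnn add1n ltnS.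
    apply/subset_leq_card/subsetP=> k; rewrite !inE -val_eqE /= Pp.
    by case: (k \in _); lia.
  apply: leq_trans (dC c p) _; apply/subset_leq_card/subsetP=> k; rewrite !inE.
  by case kC: (k \in _) => //=; have := Pmin c k kC; lia.
- by apply/setP=> k; rewrite !inE CN // inE.
have := add_row rP PS PC ph sh hC.
set g := fun i c => _ => -[pg sg gC]; exists g.
have hk i c : 0 < h i c -> exists2 k, k \in C c & h i c = k.+1 /\ k.+1 <> P c.
  move=> /(entry_col ph)[k]; rewrite hC inE => /andP[kC kP] e.
  by exists k => //; split=> //; apply/eqP.
(* Otherwise minimality would give [P c <= h i c]. This fails in the first column because [i < r],
   and later by the inequality for the previous column. *)
have below (i : 'I_n) c : i < r -> 0 < h i c -> h i c < P c.+1.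
  move=> ir; elim: c => [|c IHc] hpos.
    have [k kC [e _]] := hk _ _ hpos; have := Pmin 0 k kC; have := sh i hpos; lia.
  have [k kC [e _]] := hk _ _ hpos; have := Pmin _ k kC.
  by have := row_decr ph i c; lia.
split=> // i j c.
  move=> ij; rewrite /g; case: eqP => [jr|njr]; case: eqP => [ir|nir].
  - by rewrite ir jr ltnn in ij.
  - by have := below i c; have := PS c; rewrite -jr; lia.
  - by move=> jpos; have [k kC [e _]] := hk _ _ jpos; have := Pmin c k kC; lia.
  - exact: h3.
move=> m ij; rewrite /g; case: eqP => [ir|nir]; case: eqP => [jr|njr].
- by rewrite ir jr ltnn in ij.
- move=> Pm /hk[k kC _]; suff : 0 < P m by rewrite Pm.
  by apply: Pne; apply/set0Pn; exists k.
- by move=> _ _; apply: below; rewrite -jr.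
- exact: h4.
Qed.

(** * Translation between finite fillings and functions *)

Lemma box_ncols n (a : n.-tuple nat) r c : box a r c -> c < ncols a.
Proof.
move=> /leq_trans; apply; exact: (@leq_bigmax _ (fun i : 'I_n => tnth a i)).
Qed.

Lemma ent_ord n (a : n.-tuple nat) (f : filling a) r (c : 'I_(ncols a)) :
  ent f r c = if f (r, c) is Some k then k.+1 else 0.
Proof. by rewrite /ent valK. Qed.

Lemma ent_ge n (a : n.-tuple nat) (f : filling a) r c : ncols a <= c -> ent f r c = 0.
Proof. by move=> ac; rewrite /ent insubF // ltnNge ac. Qed.

Lemma ent_le n (a : n.-tuple nat) (f : filling a) r c : ent f r c <= n.
Proof.
case: (ltnP c (ncols a)) => [ca|/ent_ge -> //].
by rewrite -[c]/(val (Ordinal ca)) ent_ord; case: (f _).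
Qed.

Lemma ent_inj n (a : n.-tuple nat) (f g : filling a) :
  (forall r c, ent f r c = ent g r c) -> f = g.
Proof.
move=> e; apply/ffunP=> -[r c]; have := e r c; rewrite !ent_ord.
by case: (f _) (g _) => [k|] [l|] // [] /val_inj ->.
Qed.

Lemma in_shapeP n (a : n.-tuple nat) (f : filling a) :
  reflect (forall r c, (0 < ent f r c) = box a r c) (in_shape f).
Proof.
have E (r : 'I_n) (c : 'I_(ncols a)) : (f (r, c) != None) = (0 < ent f r c).
  by rewrite ent_ord; case: (f _).
apply: (iffP forallP) => [sh r c|sh r]; last first.
  by apply/forallP=> c; rewrite E sh.
case: (ltnP c (ncols a)) => [ca|ac].
  by have /forallP/(_ (Ordinal ca)) := sh r; rewrite E => /eqP.
by rewrite ent_ge //; apply/esym/negP => /box_ncols; rewrite ltnNge ac.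
Qed.

Definition filling_of n (a : n.-tuple nat) (h : 'I_n -> nat -> nat) : filling a :=
  [ffun rc : 'I_n * 'I_(ncols a) => if h rc.1 rc.2 is k.+1 then insub k else None].

Lemma ent_filling_of n (a : n.-tuple nat) (h : 'I_n -> nat -> nat) :
  (forall r c, h r c <= n) -> (forall r c, (0 < h r c) = box a r c) ->
  forall r c, ent (filling_of a h) r c = h r c.
Proof.
move=> hn sh r c; case: (ltnP c (ncols a)) => [ca|ac].
  rewrite -[c]/(val (Ordinal ca)) ent_ord ffunE /=.
  by case e: (h r c) => [|k] //; rewrite insubT // -e.
rewrite ent_ge //; apply/esym/eqP; rewrite -leqn0 leqNgt sh.
by apply/negP => /box_ncols; rewrite ltnNge ac.
Qed.

Lemma boxF n (a : n.-tuple nat) r c : ncols a <= c -> box a r c = false.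
Proof. by move=> ac; apply/negP => /box_ncols; rewrite ltnNge ac. Qed.

Lemma rows_weakly_decrP n (a : n.-tuple nat) (f : filling a) : in_shape f ->
  reflect (forall r c, ent f r c.+1 <= ent f r c) (rows_weakly_decr f).
Proof.
move=> /in_shapeP sh; apply: (iffP forallP) => [H r c|H r].
  case: (posnP (ent f r c.+1)) => [-> //|pos].
  case: (ltnP c (ncols a)) => [ca|ac]; last by rewrite sh boxF // leqW in pos.
  by have /forallP/(_ (Ordinal ca))/implyP := H r; rewrite -sh; apply.
by apply/forallP=> c; apply/implyP.
Qed.

Lemma cols_distinctP n (a : n.-tuple nat) (f : filling a) : in_shape f ->
  reflect (forall r s c, 0 < ent f r c -> ent f r c = ent f s c -> r = s)
          (cols_distinct f).
Proof.
move=> /in_shapeP sh; apply: (iffP forallP) => [H r s c pos e|H r].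
  apply/eqP; apply: contraT => rs.
  case: (ltnP c (ncols a)) => [ca|ac]; last by rewrite sh boxF in pos.
  have /forallP/(_ s)/forallP/(_ (Ordinal ca)) := H r.
  by rewrite -!sh rs /= -e pos eqxx.
apply/forallP=> s; apply/forallP=> c; apply/implyP=> /and3P[rs br bs].
by apply: contra rs => /eqP e; apply/eqP; apply: (H r s c) => //; rewrite sh.
Qed.

Lemma partial_fillingP n (a : n.-tuple nat) (f : filling a) : in_shape f ->
  reflect (partial_filling (ent f)) (rows_weakly_decr f && cols_distinct f).
Proof.
move=> sh; apply: (iffP andP) => [[/(rows_weakly_decrP sh) d /(cols_distinctP sh) i]|p].
  by split=> // r c; apply: ent_le.
by split; [apply/(rows_weakly_decrP sh)/row_decr | apply/(cols_distinctP sh)/col_inj].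
Qed.

Lemma shape_lt n (a : n.-tuple nat) (h : 'I_n -> nat -> nat) :
  (forall r c, (0 < h r c) = box a r c) ->
  forall r s m, h r m = 0 -> 0 < h s m -> tnth a r < tnth a s.
Proof.
move=> sh r s m hr; have : ~~ box a r m by rewrite -sh hr.
by rewrite sh /box; lia.
Qed.

(** Otherwise [h s c.+1 <= h r c] propagates to the right by atomicity until it makes [h r m]
    positive. This yields the type B triples. *)
Lemma atomic_row_lt n (h : 'I_n -> nat -> nat) (r s : 'I_n) c m :
  partial_filling h -> atomic h -> r < s -> h r m = 0 -> 0 < h s m ->
  0 < h r c -> h r c < h s c.+1.
Proof.
move=> ph ah rs rm sm rc; rewrite ltnNge; apply/negP => sc.
have cm : c < m.
  rewrite ltnNge; apply/negP => mc.
  by have := row_decr_le r ph mc; lia.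
have spos d : d <= m -> 0 < h s d by move=> /(row_decr_le s ph); lia.
have main d : c + d < m -> h s (c + d).+1 <= h r (c + d).
  elim: d => [|d IH]; first by rewrite addn0.
  rewrite addnS => lt; have := ah r s (c + d) rs.
  by have := IH; have := spos (c + d).+1; have := row_decr ph s (c + d).+1; lia.
have := main (m - c).-1; have := ah r s (m.-1) rs.
rewrite (_ : c + (m - c).-1 = m.-1); last lia.
by rewrite prednK ?rm; lia.
Qed.

(** Type A triples are atomicity when the lower row is at least as long. When the higher row is
    longer, type B triples give [lt4], which makes the premises of atomicity contradictory. *)
Lemma atom_fillingP n (a : n.-tuple nat) (f : filling a) : in_shape f ->
  reflect [/\ partial_filling (ent f), starts_at_row (ent f) & atomic (ent f)]
          (atom_filling f).
Proof.
move=> shf; have sh := elimT (in_shapeP f) shf.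
rewrite /atom_filling shf andTb andbA.
have [pf|] := partial_fillingP shf; last by move=> np; constructor=> -[].
rewrite andTb.
have startP : reflect (starts_at_row (ent f)) (first_col_is_row f).
  apply: (iffP forallP) => [H r|H r]; first by rewrite sh => b; apply/eqP/(implyP (H r)).
  by apply/implyP; rewrite -sh => /H/eqP.
apply: (iffP andP) => [[tr /startP st]|[_ st at_]]; split=> //; last first.
- exact/startP.
- apply/forallP=> r; apply/forallP=> s; apply/forallP=> c; apply/implyP=> rs.
  apply/andP; split; apply/implyP=> /and4P[len b1 b2 b3]; rewrite /inv_triple.
    have := row_decr pf r c; have := at_ r s c rs; rewrite sh b3.
    by lia.
  (* Column [tnth a r] is the first one outside row [r], and the longer row [s] reaches it. *)
  have rm : ent f r (tnth a r) = 0.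
    by apply/eqP; rewrite -leqn0 leqNgt sh /box ltnn.
  have := @atomic_row_lt _ _ r s c (tnth a r) pf at_ rs rm.
  by rewrite !sh b3 /box len; have := row_decr pf s c; lia.
have tri (r s : 'I_n) c : r < s ->
    ([&& tnth a s <= tnth a r, box a r c, box a r c.+1 & box a s c.+1] ->
        inv_triple (ent f s c.+1) (ent f r c) (ent f r c.+1)) /\
    ([&& tnth a r < tnth a s, box a s c, box a s c.+1 & box a r c] ->
        inv_triple (ent f r c) (ent f s c) (ent f s c.+1)).
  move=> rs; case: (ltnP c (ncols a)) => [ca|ac]; last first.
    by rewrite !(@boxF _ _ _ c) ?andbF.
  have /forallP/(_ r)/forallP/(_ s)/forallP/(_ (Ordinal ca)) := tr.
  by rewrite rs /= => /andP[/implyP ? /implyP ?].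
(* The first column holds the row indices, which excludes one alternative of the inversion
   condition; each inequality obtained excludes it in the next column. *)
have lt4 (r s : 'I_n) c : r < s -> tnth a r < tnth a s -> box a r c ->
    ent f r c < ent f s c.+1.
  move=> rs len; elim: c => [|c IH] b.
    have [_] := tri r s 0 rs; move: (b); rewrite /box len /inv_triple => rc.
    have bs0 : box a s 0 by rewrite /box; lia.
    have := st r; have := st s; rewrite !sh b bs0 => /(_ isT) -> /(_ isT) ->.
    by rewrite /box in b bs0 *; lia.
  have := tri r s c.+1 rs; rewrite b len /inv_triple /= => -[_].
  have b' : box a r c by rewrite /box in b *; lia.
  have := IH b'; have := row_decr pf r c.
  by rewrite /box in b *; lia.
move=> r s c rs spos sr; case: (leqP (tnth a s) (tnth a r)) => len.
  have [] := tri r s c rs; have bs : box a s c.+1 by rewrite -sh.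
  have := row_decr pf s c; have := row_decr pf r c.
  by rewrite len /inv_triple /box in bs *; lia.
have := lt4 r s c rs len; rewrite -sh; lia.
Qed.

Lemma quasi_keyP n (a : n.-tuple nat) (f : filling a) : in_shape f ->
  reflect [/\ partial_filling (ent f), cond3 (ent f), cond4 (ent f),
              forall r c, ent f r c <= r.+1 &
              forall r s : 'I_n, r < s -> 0 < ent f r 0 -> 0 < ent f s 0 ->
                ent f r 0 < ent f s 0]
          (quasi_key f).
Proof.
move=> shf; have sh := elimT (in_shapeP f) shf.
rewrite /quasi_key shf andTb; apply: (iffP and4P).
  case=> /andP[rd /forallP le_row] /andP[cd /forallP first_col] /forallP q3 /forallP q4.
  have pf : partial_filling (ent f) by apply/(partial_fillingP shf)/andP.
  split=> // [r s c rs spos lt|r s c m rs rm sm rpos|r c|r s rs].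
  - case: (ltnP c (ncols a)) => [ca|/(ent_ge f s) s0]; last by rewrite s0 in spos.
    have /forallP/(_ s)/forallP/(_ (Ordinal ca))/implyP := q3 r.
    by rewrite /= rs -!sh spos lt (ltn_trans spos lt) => /(_ isT)/andP[].
  - have len := shape_lt sh rm sm.
    case: (ltnP c (ncols a)) => [ca|/(ent_ge f r) r0]; last by rewrite r0 in rpos.
    have /forallP/(_ s)/forallP/(_ (Ordinal ca))/implyP := q4 r.
    rewrite /= rs len; move: rpos; rewrite sh /box => rpos; apply.
    by rewrite rpos /=; lia.
  - case: (posnP (ent f r c)) => [-> //|pos].
    case: (ltnP c (ncols a)) => [ca|/(ent_ge f r) -> //].
    have /forallP/(_ (Ordinal ca))/implyP := le_row r.
    by rewrite -sh; apply.
  - move=> r0 s0; have /forallP/(_ s)/implyP := first_col r.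
    by apply; rewrite rs -!sh r0.
case=> pf c3 c4 le_row first_col.
have /andP[rd cd] : rows_weakly_decr f && cols_distinct f by apply/(partial_fillingP shf).
split.
- by rewrite /qk_cond1 rd; apply/forallP=> r; apply/forallP=> c; apply/implyP.
- rewrite /qk_cond2 cd; apply/forallP=> r; apply/forallP=> s; apply/implyP.
  by rewrite -!sh => /and3P[]; apply: first_col.
- apply/forallP=> r; apply/forallP=> s; apply/forallP=> c; apply/implyP.
  rewrite -!sh => /and4P[rs rpos spos lt]; have := c3 r s c rs spos lt.
  by move=> lt'; rewrite lt' andbT; apply: leq_ltn_trans lt'.
apply/forallP=> r; apply/forallP=> s; apply/forallP=> c; apply/implyP.
move=> /and4P[rs len br _]; apply: (c4 r s c (tnth a r)) => //; rewrite ?sh //.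
by apply/eqP; rewrite -leqn0 leqNgt sh /box ltnn.
Qed.

(** * Row transports and dominance of compositions *)

(** Combinatorial form of [b >= a] with equal flattenings: an order-preserving bijection between the
    nonempty rows that moves no row up. *)
Record row_transport n (a b : n.-tuple nat) (rho : 'I_n -> 'I_n) : Prop :=
  RowTransport {
    transport_len : forall r, 0 < tnth a r -> tnth b (rho r) = tnth a r;
    transport_le : forall r, 0 < tnth a r -> rho r <= r;
    transport_lt : forall r s : 'I_n, 0 < tnth a r -> 0 < tnth a s -> r < s ->
      rho r < rho s;
    transport_onto : forall i, 0 < tnth b i -> exists2 r, 0 < tnth a r & rho r = i }.

Lemma sumn_take n (a : n.-tuple nat) i : i <= n ->
  sumn (take i a) = \sum_(r < n | r < i) tnth a r.
Proof.
move=> le_in; rewrite sumnE (big_nth 0) size_take_min size_tuple (minn_idPl le_in).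
rewrite big_nat; under eq_bigr => j /andP[_ ji] do rewrite nth_take //.
rewrite -big_nat big_mkord (big_ord_widen _ (nth 0 a) le_in).
by apply: eq_bigr => r _; rewrite (tnth_nth 0).
Qed.

Lemma dominatesP n (a b : n.-tuple nat) :
  reflect (forall i, i <= n ->
             \sum_(r < n | r < i) tnth a r <= \sum_(r < n | r < i) tnth b r)
          (dominates b a).
Proof.
apply: (iffP forallP) => [H i le_in|H i].
  have lt : i < (size a).+1 by rewrite size_tuple.
  by have := H (Ordinal lt); rewrite /= !sumn_take.
have le_in : i <= n by rewrite -[n in _ <= n](size_tuple a) -ltnS.
by rewrite !sumn_take //; apply: H.
Qed.

Lemma leq_sum_sub (I : finType) (P Q : pred I) (F : I -> nat) :
  (forall i, P i -> 0 < F i -> Q i) -> \sum_(i | P i) F i <= \sum_(i | Q i) F i.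
Proof.
move=> PQ; rewrite big_mkcond [leqRHS]big_mkcond; apply: leq_sum => i _.
by have := PQ i; case: (P i) (Q i) (F i) => [] [] [|k] //= /(_ isT isT).
Qed.

Lemma flat_enum n (a : n.-tuple nat) :
  flat a = [seq tnth a r | r <- enum 'I_n & 0 < tnth a r].
Proof.
rewrite /flat -{1}(map_tnth_enum a) filter_map; congr map.
by apply: eq_filter => r /=; rewrite lt0n.
Qed.

Lemma sorted_support n (p : pred 'I_n) :
  sorted (fun r s : 'I_n => r < s) [seq r <- enum 'I_n | p r].
Proof.
apply: sorted_filter; first by move=> ? ? ?; apply: ltn_trans.
by have := iota_ltn_sorted 0 n; rewrite -val_enum_ord sorted_map.
Qed.

Lemma transport_inj n (a b : n.-tuple nat) rho : row_transport a b rho ->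
  {in [pred r | 0 < tnth a r] &, injective rho}.
Proof.
move=> T r s ra sa e; apply/val_inj; case: (ltngtP r s) => // lt.
  by have := transport_lt T ra sa lt; rewrite e ltnn.
by have := transport_lt T sa ra lt; rewrite e ltnn.
Qed.

Lemma transport_flat n (a b : n.-tuple nat) rho : row_transport a b rho ->
  flat b = flat a.
Proof.
move=> T; rewrite !flat_enum.
have -> : [seq i <- enum 'I_n | 0 < tnth b i] =
    [seq rho r | r <- [seq r <- enum 'I_n | 0 < tnth a r]].
  apply: (@irr_sorted_eq _ (fun r s : 'I_n => r < s)).
  - by move=> ? ? ?; apply: ltn_trans.
  - by move=> ?; rewrite ltnn.
  - exact: sorted_support.
  - rewrite sorted_map; apply: (sub_in_sorted (P := [pred r | 0 < tnth a r]))
      (sorted_support (fun r => 0 < tnth a r)).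
      by move=> r s; rewrite !inE => ra sa; apply: transport_lt T _ _ ra sa.
    by apply/allP=> r; rewrite mem_filter => /andP[].
  - move=> i; rewrite mem_filter mem_enum andbT; apply/idP/mapP.
      move=> /(transport_onto T)[r ra <-]; exists r => //.
      by rewrite mem_filter ra mem_enum.
    by case=> r; rewrite mem_filter => /andP[ra _] ->; rewrite (transport_len T).
rewrite -map_comp; apply/eq_in_map => r; rewrite mem_filter => /andP[ra _] /=.
exact: transport_len T _ ra.
Qed.

(** Nonempty rows of [a] below [i] go to distinct rows of [b] below [i] of the same lengths. *)
Lemma transport_dominates n (a b : n.-tuple nat) rho : row_transport a b rho ->
  dominates b a.
Proof.
move=> T; apply/dominatesP => i _; set A := [pred r : 'I_n | (r < i) && (0 < tnth a r)].
apply: (@leq_trans (\sum_(r in A) tnth a r)).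
  by apply: leq_sum_sub => r ri ra; rewrite inE ri.
apply: (@leq_trans (\sum_(j in rho @: A) tnth b j)).
  rewrite big_imset => [|r s /andP[_ ra] /andP[_ sa]]; last exact: transport_inj T _ _ ra sa.
  by rewrite leq_eqVlt; apply/orP; left; apply/eqP; apply: eq_bigr => r /andP[_ ra];
     rewrite (transport_len T).
apply: leq_sum_sub => j /imsetP[r /andP[ri ra] ->] _.
exact: leq_ltn_trans (transport_le T ra) ri.
Qed.

Lemma exists_transport n (a b : n.-tuple nat) : dominates b a -> flat b = flat a ->
  exists rho, row_transport a b rho.
Proof.
move=> /dominatesP dom; rewrite !flat_enum.
set la := [seq r <- enum 'I_n | 0 < tnth a r].
set lb := [seq r <- enum 'I_n | 0 < tnth b r] => eqf.
have sz : size lb = size la.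
  by have := congr1 size eqf; rewrite !size_map.
have ina r : (r \in la) = (0 < tnth a r) by rewrite mem_filter mem_enum andbT.
have inb r : (r \in lb) = (0 < tnth b r) by rewrite mem_filter mem_enum andbT.
have ula : uniq la by rewrite filter_uniq // enum_uniq.
have ulb : uniq lb by rewrite filter_uniq // enum_uniq.
(* Nonempty rows of equal rank are matched; equal flattenings make their lengths agree. *)
pose rho r := nth r lb (index r la).
have ilt r : 0 < tnth a r -> index r la < size lb by rewrite sz index_mem ina.
have len r : 0 < tnth a r -> tnth b (rho r) = tnth a r.
  move=> ra; have := congr1 (fun s => nth 0 s (index r la)) eqf.
  by rewrite !(nth_map r) ?ilt // -?sz ?ilt // nth_index // ina.
have lt_trans : transitive (fun r s : 'I_n => r < s) by move=> ? ? ?; apply: ltn_trans.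
have lt r s : 0 < tnth a r -> 0 < tnth a s -> r < s -> rho r < rho s.
  move=> ra sa rs; rewrite /rho (set_nth_default r s) ?ilt //.
  apply: (sorted_ltn_nth lt_trans) => //; rewrite ?inE ?ilt //; first exact: sorted_support.
  rewrite ltnNge; apply/negP => le.
  have := @sorted_leq_nth _ (fun r s : 'I_n => r <= s) _ _ r la _
    (index s la) (index r la).
  rewrite !inE !index_mem !ina ra sa !nth_index ?ina // => H.
  have : s <= r; last by rewrite leqNgt rs.
  apply: H => //; first by move=> ? ? ?; apply: leq_trans.
  by apply: sub_sorted (sorted_support _) => ? ? /ltnW.
have onto i : 0 < tnth b i -> exists2 r, 0 < tnth a r & rho r = i.
  move=> bi; have ii : index i lb < size la by rewrite -sz index_mem inb.
  exists (nth i la (index i lb)); first by rewrite -ina mem_nth.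
  by rewrite /rho index_uniq // (set_nth_default i) ?sz // nth_index // inb.
(* If [r < rho r], the nonempty rows of [b] up to [r] are images of rows of [a] below [r], so their
   sum misses [tnth a r], against dominance at [r.+1]. *)
exists rho; split=> // r ra; rewrite leqNgt; apply/negP => rr.
have := dom r.+1 (ltn_ord r); rewrite leqNgt => /negP; apply.
set A := [pred s : 'I_n | (s < r) && (0 < tnth a s)].
apply: (@leq_ltn_trans (\sum_(j in rho @: A) tnth b j)).
  apply: leq_sum_sub => j jr /onto[s sa rhos].
  apply/imsetP; exists s => //; rewrite inE sa andbT ltnNge; apply/negP => rs.
  have : rho r <= j.
    rewrite -rhos; move: rs; rewrite leq_eqVlt => /orP[/eqP/val_inj -> //|rs].
    by rewrite ltnW // lt.
  by rewrite leqNgt (leq_trans _ rr).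
have inj : {in A &, injective rho}.
  move=> s t /andP[_ sa] /andP[_ ta] e; apply/val_inj.
  case: (ltngtP s t) => // st; first by have := lt s t sa ta st; rewrite e ltnn.
  by have := lt t s ta sa st; rewrite e ltnn.
rewrite big_imset // (eq_bigr (tnth a)) => [|s /andP[_ sa]]; last exact: len.
rewrite [ltnRHS](bigD1 r) //= -[ltnLHS]add0n -addSn.
apply: leq_add => //; apply: leq_sum_sub => s /andP[sr _] _.
by rewrite ltnS (ltnW sr) /= -val_eqE neq_ltn sr.
Qed.

(** * The correspondence preserving column sets *)

(** Each row slides to the index given by its first entry. Row order is kept, so [cond3] and [cond4]
    survive, and the atomic filling with the same columns has the resulting shape. *)
Lemma atom_of_quasi n (a : n.-tuple nat) (f : filling a) :
  in_shape f -> quasi_key f ->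
  exists b : n.-tuple nat, [/\ dominates b a, flat b = flat a &
    exists f' : filling b, [/\ in_shape f', atom_filling f' &
      forall c, col (ent f') c = col (ent f) c]].
Proof.
move=> shf /(quasi_keyP shf)[pf c3 c4 le_row first_incr].
have sh := elimT (in_shapeP f) shf.
pose row_of (i : 'I_n) := [pick r | ent f r 0 == i.+1].
pose g i c := if row_of i is Some r then ent f r c else 0.
pose b := [tuple (if row_of i is Some r then tnth a r else 0) | i < n].
have rowE r (i : 'I_n) : ent f r 0 = i.+1 -> row_of i = Some r.
  move=> e; rewrite /row_of; case: pickP => [s /eqP es|/(_ r)]; last by rewrite e eqxx.
  by congr Some; apply: (col_inj pf (c := 0)); rewrite es.
have row_ofP i r : row_of i = Some r -> ent f r 0 = i.+1.
  by rewrite /row_of; case: pickP => // s /eqP es [<-].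
have lenE r : (0 < tnth a r) = (0 < ent f r 0) by rewrite sh.
have row_lt i j r s : row_of i = Some r -> row_of j = Some s -> i < j -> r < s.
  move=> /row_ofP ei /row_ofP ej ij; case: (ltngtP r s) => // [sr|/val_inj rs].
    by have := first_incr s r sr; rewrite ei ej; lia.
  by have := ei; rewrite rs ej; lia.
have pg : partial_filling g.
  split=> [i c|i j c|i c]; rewrite /g.
  - by case: (row_of i) => // r; apply: row_decr.
  - case ei: (row_of i) => [r|//] pos; case ej: (row_of j) => [s|] e; last by rewrite e in pos.
    have rs := col_inj pf pos e; apply/val_inj/succn_inj.
    by rewrite /= -(row_ofP _ _ ei) -(row_ofP _ _ ej) rs.
  - by case: (row_of i) => // r; apply: ent_le.
have sg : starts_at_row g.
  by move=> i; rewrite /g; case ei: (row_of i) => [r|//] _; apply: row_ofP.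
have g3 : cond3 g.
  move=> i j c ij; rewrite /g; case ej: (row_of j) => [s|//].
  by case ei: (row_of i) => [r|] //; apply: c3; apply: row_lt ei ej ij.
have g4 : cond4 g.
  move=> i j c m ij; rewrite /g; case ei: (row_of i) => [r|] //.
  by case ej: (row_of j) => [s|//]; apply: c4; apply: row_lt ei ej ij.
have colg c : col g c = col (ent f) c.
  apply/setP=> k; apply/colP/colP => [[i]|[r e]].
    by rewrite /g; case: (row_of i) => // r e; exists r.
  have [|i _ ei] := @entry_col _ _ r 0 pf.
    by apply: leq_trans (row_decr_le r pf (leq0n c)); rewrite e.
  by exists i; rewrite /g (rowE _ _ ei).
have shg i c : (0 < g i c) = box b i c.
  by rewrite /box tnth_mktuple /g; case: (row_of i) => // r; rewrite sh.
have [h [ph sth ah colh]] := exists_atomic (dominated_col pg).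
have shh i c : (0 < h i c) = box b i c.
  by rewrite -shg; apply: atomic_quasi_shape.
have entE := ent_filling_of (entry_le ph) shh.
have colE c : col (ent (filling_of b h)) c = col (ent f) c.
  by rewrite -colg -colh; apply/setP=> k; rewrite !inE; under eq_existsb do rewrite entE.
have shF : in_shape (filling_of b h) by apply/in_shapeP => r c; rewrite entE.
(* The predecessor undoes the shift of entries; the bound of the entries by the row index says that
   no row moves up. *)
pose rho r := insubd r (ent f r 0).-1.
have rhoE r : 0 < tnth a r -> ent f r 0 = (rho r).+1.
  rewrite lenE => pos; have := ent_le f r 0.
  by rewrite /rho val_insubd; case: ifP; lia.
have T : row_transport a b rho.
  split=> [r ra|r ra|r s ra sa rs|i].
  - by rewrite tnth_mktuple (rowE r) // rhoE.
  - by rewrite -ltnS -rhoE.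
  - by rewrite -ltnS -!rhoE //; apply: first_incr; rewrite // -lenE.
  rewrite tnth_mktuple; case ei: (row_of i) => [r|//] ra; exists r => //.
  by apply/val_inj/succn_inj; rewrite -rhoE // (row_ofP _ _ ei).
exists b; split; [exact: transport_dominates T | exact: transport_flat T |].
exists (filling_of b h); split=> //; apply/(atom_fillingP shF); split.
- by split=> [r c|r s c|r c]; rewrite !entE;
    [apply: row_decr | apply: col_inj | apply: entry_le].
- by move=> r; rewrite entE; apply: sth.
- by move=> r s c; rewrite !entE; apply: ah.
Qed.

(** The filling from [exists_quasi] with these columns again has shape [b]; pulling its rows back
    along a transport gives shape [a]. *)
Lemma quasi_of_atom n (a b : n.-tuple nat) (f : filling b) :
  dominates b a -> flat b = flat a -> in_shape f -> atom_filling f ->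
  exists f' : filling a, [/\ in_shape f', quasi_key f' &
    forall c, col (ent f') c = col (ent f) c].
Proof.
move=> dom eqf shf /(atom_fillingP shf)[pf sf af].
have sh := elimT (in_shapeP f) shf.
have [rho T] := exists_transport dom eqf.
have [|h [ph sth h3 h4 colh]] := @exists_quasi n (ncols b) _ (dominated_col pf).
  move=> c bc; apply/setP=> k; rewrite in_set0; apply/negbTE/colP => -[r].
  by rewrite ent_ge.
have shh r c : (0 < h r c) = box b r c.
  by rewrite -sh; apply/esym; apply: atomic_quasi_shape.
pose g r c := if 0 < tnth a r then h (rho r) c else 0.
have shg r c : (0 < g r c) = box a r c.
  rewrite /g /box; case: (posnP (tnth a r)) => [-> //|ra].
  by rewrite shh /box (transport_len T).
have gn r c : g r c <= n by rewrite /g; case: ifP => // _; apply: entry_le.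
have entE := ent_filling_of gn shg.
have colg c : col g c = col (ent f) c.
  rewrite -colh; apply/setP=> k; apply/colP/colP => [[r]|[i e]].
    by rewrite /g; case: ifP => // _ e; exists (rho r).
  have := shh i c; rewrite e /box => /esym ic.
  have [|r ra ri] := transport_onto T (i := i); first exact: leq_ltn_trans ic.
  by exists r; rewrite /g ra ri.
have colE c : col (ent (filling_of a g)) c = col (ent f) c.
  by rewrite -colg; apply/setP=> k; rewrite !inE; under eq_existsb do rewrite entE.
have shF : in_shape (filling_of a g) by apply/in_shapeP => r c; rewrite entE.
have pos_len r c : 0 < g r c -> 0 < tnth a r by rewrite /g; case: ifP.
have gE r : 0 < tnth a r -> g r =1 h (rho r) by move=> ra c; rewrite /g ra.
exists (filling_of a g); split=> //; apply/(quasi_keyP shF); split.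
- split=> [r c|r s c|r c]; rewrite !entE //.
    by rewrite /g; case: ifP => // _; apply: row_decr.
  move=> pos e; have ra := pos_len _ _ pos; have sa : 0 < tnth a s.
    by apply: (pos_len s c); rewrite -e.
  apply: (transport_inj T ra sa); apply: (col_inj ph (c := c)).
    by rewrite -gE.
  by rewrite -!gE.
- move=> r s c rs; rewrite !entE => spos lt.
  have ra := pos_len _ _ (ltn_trans spos lt); have sa := pos_len _ _ spos.
  move: spos lt; rewrite !gE //; apply: h3; exact: transport_lt T _ _ ra sa rs.
- move=> r s c m rs; rewrite !entE => rm spos rpos.
  have ra := pos_len _ _ rpos; have sa := pos_len _ _ spos.
  move: rm spos rpos; rewrite !gE //; apply: h4; exact: transport_lt T _ _ ra sa rs.
- move=> r c; rewrite entE /g; case: ifP => // ra.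
  apply: leq_trans (row_decr_le _ ph (leq0n c)) _.
  case: (posnP (h (rho r) 0)) => [-> //|/sth ->].
  by rewrite ltnS (transport_le T).
move=> r s rs; rewrite !entE => rpos spos.
have ra := pos_len _ _ rpos; have sa := pos_len _ _ spos.
move: rpos spos; rewrite !gE // => /sth -> /sth ->.
by rewrite ltnS; apply: transport_lt T _ _ ra sa rs.
Qed.

(** * Weights and summation over column sets *)

(** A common bound [N] puts the column sets of fillings of different shapes into one finite type. *)
Definition column_sets n (a : n.-tuple nat) N (f : filling a) :
    {ffun 'I_N -> {set 'I_n}} :=
  [ffun c : 'I_N => col (ent f) c].

Lemma column_sets_eq n (a b : n.-tuple nat) N (f : filling a) (g : filling b) :
  ncols a <= N -> ncols b <= N -> column_sets N f = column_sets N g ->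
  forall c, col (ent f) c = col (ent g) c.
Proof.
move=> aN bN e c; case: (ltnP c N) => [cN|Nc].
  by have /ffunP/(_ (Ordinal cN)) := e; rewrite !ffunE.
apply/setP=> k; rewrite !inE.
by under eq_existsb do rewrite (ent_ge f) ?(leq_trans aN) //;
   under [RHS]eq_existsb do rewrite (ent_ge g) ?(leq_trans bN) //.
Qed.

Definition column_monomial n N (K : {ffun 'I_N -> {set 'I_n}}) : {mpoly int[n]} :=
  (\prod_(c < N) \prod_(k in K c) 'X_k)%R.

(** Entries of a column are distinct, so each member of its column set contributes one variable;
    columns from [ncols a] to [N] contribute 1. *)
Lemma wt_column_sets n (a : n.-tuple nat) N (f : filling a) : ncols a <= N ->
  partial_filling (ent f) -> wt f = column_monomial (column_sets N f).
Proof.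
move=> aN pf; pose F c : {mpoly int[n]} := (\prod_(k in col (ent f) c) 'X_k)%R.
have FE c : F c = (\prod_r \prod_(k < n | ent f r c == k.+1) 'X_k)%R.
  rewrite (exchange_big_dep xpredT) //= /F big_mkcond; apply: eq_bigr => k _.
  case: ifPn => [/colP[r e]|/colP no].
    rewrite (big_pred1 r) // => s; apply/eqP/eqP => [e'|-> //].
    by apply: (col_inj pf (c := c)); rewrite e'.
  by rewrite big_pred0 // => r; apply/eqP => e; apply: no; exists r.
rewrite /column_monomial; under [RHS]eq_bigr => c _ do rewrite ffunE -/(F c).
rewrite -(big_mkord xpredT F) (big_cat_nat (n := ncols a)) //=.
rewrite [X in (_ * X)%R]big_nat [X in (_ * X)%R]big1 => [|c /andP[ac _]]; last first.
  rewrite FE big1 // => r _; rewrite big_pred0 // => k.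
  by rewrite ent_ge.
rewrite GRing.mulr1 big_mkord /wt; under [RHS]eq_bigr => c _ do rewrite FE.
rewrite [RHS]exchange_big pair_big /=; apply: eq_bigr => -[r c] _ /=.
rewrite ent_ord; case: (f (r, c)) => [k|].
  by rewrite (big_pred1 k) // => l; rewrite eqSS eq_sym.
by rewrite big_pred0.
Qed.

Lemma sum_wt_column_sets n (a : n.-tuple nat) N (Q : pred (filling a)) :
  ncols a <= N -> (forall f, Q f -> partial_filling (ent f)) ->
  {in Q &, injective (@column_sets n a N)} ->
  (\sum_(f | Q f) wt f =
   \sum_(K in column_sets N @: Q) column_monomial K)%R.
Proof.
move=> aN Qp Qinj; rewrite big_imset //; apply: eq_bigr => f Qf.
by apply: wt_column_sets => //; apply: Qp.
Qed.

Lemma tnth_le_sumn n (a : n.-tuple nat) r : tnth a r <= sumn a.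
Proof.
have := sumn_take a (leqnn n); rewrite take_oversize ?size_tuple // => ->.
by rewrite (bigD1 r) //= leq_addr.
Qed.

Lemma ncols_le_sumn n (a : n.-tuple nat) : ncols a <= (sumn a).+1.
Proof. by apply/bigmax_leqP => r _; rewrite leqW // tnth_le_sumn. Qed.

Lemma sumn_flat s : sumn (flat s) = sumn s.
Proof. by elim: s => [|[|x] s IH] //=; rewrite IH. Qed.

Local Open Scope ring_scope.

Theorem theorem3p4 (n : nat) (a : n.-tuple nat) :
  qkey_poly a =
  \sum_(b : n.-tuple 'I_(sumn a).+1 |
          dominates (tuple_of_bounded b) a &&
          (flat (tuple_of_bounded b) == flat a))
     atom (tuple_of_bounded b).
Proof.
(* Shapes with the flattening of [a] have the same sum of parts, so [N] bounds their numbers of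
   columns. *)
pose N := (sumn a).+1.
have flatN (b : n.-tuple nat) : flat b = flat a -> (ncols b <= N)%N.
  by move=> e; rewrite /N -sumn_flat -e sumn_flat ncols_le_sumn.
have aN : (ncols a <= N)%N by apply: flatN.
have qin (f : filling a) : quasi_key f -> in_shape f by case/and5P.
have ain (b : n.-tuple nat) (f : filling b) : atom_filling f -> in_shape f.
  by case/and5P.
rewrite /qkey_poly (sum_wt_column_sets aN) => [|f qf|f g qf qg /column_sets_eq e].
- set B := (_ @: _).
  pose A (b : n.-tuple 'I_N) :=
    column_sets N @: (@atom_filling n (tuple_of_bounded b)).
  transitivity (\sum_(b : n.-tuple 'I_N | dominates (tuple_of_bounded b) a &&
      (flat (tuple_of_bounded b) == flat a)) \sum_(K in A b) column_monomial K)%R;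
    last first.
    apply: eq_bigr => b /andP[_ /eqP /flatN bN].
    rewrite /atom (sum_wt_column_sets bN) // => [f af|f g af ag /column_sets_eq e].
      by have [] := elimT (atom_fillingP (ain _ _ af)) af.
    have [pf sf atf] := elimT (atom_fillingP (ain _ _ af)) af.
    have [pg sg atg] := elimT (atom_fillingP (ain _ _ ag)) ag.
    by apply: ent_inj; apply: atomic_uniq => //; apply: e.
  (* Every [K] arising from an atom filling on the right also arises from a quasi-key tableau of
     shape [a]. *)
  rewrite (exchange_big_dep (mem B)) => [|b K /andP[dom /eqP fl] /imsetP[f af ->]];
    last first.
    have [g [_ qg e]] := quasi_of_atom dom fl (ain _ _ af) af.
    by apply/imsetP; exists g => //; apply/ffunP=> c; rewrite !ffunE e.
  apply: eq_bigr => K /imsetP[f qf ->].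
  have [b [dom fl [g [shg ag e]]]] := atom_of_quasi (qin _ qf) qf.
  (* Each part of [b] is at most the sum of the parts, which is [sumn a], so [inord] preserves
     it. *)
  pose b' : n.-tuple 'I_(sumn a).+1 := [tuple inord (tnth b i) | i < n].
  have bb' : tuple_of_bounded b' = b.
    apply: eq_from_tnth => i; rewrite tnth_map tnth_mktuple inordK //.
    by rewrite ltnS -sumn_flat -fl sumn_flat tnth_le_sumn.
  (* Exactly one shape contributes to [K]: atom fillings with these columns have equal entries,
     hence equal row lengths. *)
  rewrite (big_pred1 b') // => d; apply/idP/eqP => [/andP[/andP[_ /eqP /flatN dN]]|->].
    move=> /imsetP[h ah]; have [ph sh ath] := elimT (atom_fillingP (ain _ _ ah)) ah.
    move=> K2; have e2 c : col (ent g) c = col (ent h) c.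
      by rewrite e; apply: (column_sets_eq aN dN).
    have [pg sg atg] := elimT (atom_fillingP shg) ag.
    have gh := atomic_uniq pg sg atg ph sh ath e2.
    suff : tuple_of_bounded d = tuple_of_bounded b'.
      by move=> /(congr1 val)/(inj_map (@ord_inj _))/val_inj.
    rewrite bb'; apply: eq_from_tnth => i.
    have := elimT (in_shapeP h) (ain _ _ ah) i; have := elimT (in_shapeP g) shg i.
    rewrite /box => sg' sh'; apply/eqP; rewrite eqn_leq; apply/andP; split.
      by rewrite leqNgt -sh' -gh sg' ltnn.
    by rewrite leqNgt -sg' gh sh' ltnn.
  apply/andP; split; first by rewrite bb' dom fl eqxx.
  rewrite /A bb'; apply/imsetP; exists g => //.
  by apply/ffunP=> c; rewrite !ffunE e.
- by have [] := elimT (quasi_keyP (qin _ qf)) qf.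
have [pf f3 f4 _ _] := elimT (quasi_keyP (qin _ qf)) qf.
have [pg g3 g4 _ _] := elimT (quasi_keyP (qin _ qg)) qg.
apply: ent_inj; apply: quasi_uniq => //.
- by move=> r c; rewrite (elimT (in_shapeP f) (qin _ qf))
    (elimT (in_shapeP g) (qin _ qg)).
- exact: e.
by exists (ncols a) => r c; apply: ent_ge.
Qed.
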